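(* Given positive integers $r,d$, there exists an integer $t$ such that the following holds. Let $\mathcal{B}_1,\dots,\mathcal{B}_{d+1}$ be finite families of axis-parallel boxes in $\mathbb{R}^d$, each of cardinality $t$, and let $S\subseteq\mathbb{R}^d$ be a discrete set. Suppose that for every choice of $B_i\in\mathcal{B}_i$ for each $i\in[d+1]$, the intersection $\bigcap_{i=1}^{d+1}B_i$ contains at least one point of $S$. Then there exist an index $l\in[d+1]$ and $r$ boxes in $\mathcal{B}_l$ whose intersection contains at least one point of $S$.
   Context: An axis-parallel box in $\mathbb{R}^d$ is a set of the form $[a_1,b_1]\times\cdots\times[a_d,b_d]$ with $a_i\le b_i$ real numbers. *)

(* Defs.v *)
From mathcomp Require Import all_boot all_order all_algebra.
From mathcomp Require Import all_classical all_reals all_analysis.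
Import Order.TTheory GRing.Theory Num.Theory.
Import numFieldNormedType.Exports.

Set Implicit Arguments.
Unset Strict Implicit.
Unset Printing Implicit Defensive.

Local Open Scope classical_set_scope.
Local Open Scope ring_scope.

Definition axis_parallel_box (R : realType) (d : nat) (B : set 'rV[R]_d) : Prop :=
  exists a b : 'rV[R]_d,
    (forall i : 'I_d, a 0 i <= b 0 i) /\
    B = [set x | forall i : 'I_d, a 0 i <= x 0 i <= b 0 i].

(* Discrete in the subspace topology; closedness (local finiteness) is not
   required. *)
Definition discrete_set (T : topologicalType) (S : set T) : Prop :=
  S `<=` isolated S.

(* Main.v *)
(** Index the boxes of each colour by [1..t] and choose for every tuple of
indices a point of [S] in the corresponding intersection; discreteness of [S]
plays no role.  Label a tuple [I], a colour [c] and an index [i] by a coordinate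
and a side separating the point [p I] from box [i] of colour [c], or by [None]
if the point lies in that box.  A multipartite Ramsey argument gives a subgrid,
with [r] indices in every colour, in which the label depends only on [c], [I c]
and [i].  If in colour [c] all labels are [None], every point of the subgrid
lies in [r] boxes of that colour.  Otherwise there are two indices [x], [y] of
colour [c] and a coordinate in which all points with [I c = x] precede all
points with [I c = y].  Two colours cannot use the same coordinate: the tuples
[(x, y')] and [(y, x')] would each have to precede the other.  As there are more
colours than coordinates, some colour has only [None] labels. *)
Require Import Defs.
From mathcomp Require Import all_boot all_order all_algebra.
From mathcomp Require Import all_classical all_reals all_analysis.
Import Order.TTheory GRing.Theory Num.Theory.
Import numFieldNormedType.Exports.

Set Implicit Arguments.
Unset Strict Implicit.
Unset Printing Implicit Defensive.

Lemma exists_subset_card (T : finType) (A : {set T}) (n : nat) :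
  n <= #|A| -> exists2 B : {set T}, B \subset A & #|B| = n.
Proof.
move=> nA; exists [set x in take n (enum A)].
  by apply/fintype.subsetP => x; rewrite inE => /mem_take; rewrite mem_enum.
rewrite cardsE (card_uniqP _) ?take_uniq ?enum_uniq//.
by rewrite size_takel// -cardE.
Qed.

Lemma exists_large_fiber (T L : finType) (f : T -> L) (m : nat) :
  #|L| * m < #|T| -> exists l, m < #|[set x | f x == l]|.
Proof.
move=> h; apply/existsP; apply: contraLR h; rewrite negb_exists => /forallP h.
rewrite -leqNgt -sum1_card (partition_big f predT)//=.
rewrite -sum_nat_const; apply: leq_sum => l _.
by rewrite sum1dep_card leqNgt.
Qed.

(** * Multipartite Ramsey theorems on grids *)

Section GridRamsey.
Variable C : finType.
Implicit Types T L : finType.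

Definition upd T (I : {ffun C -> T}) (c : C) (x : T) : {ffun C -> T} :=
  [ffun e => if e == c then x else I e].

Definition in_grid T (Y : C -> {set T}) (I : {ffun C -> T}) : Prop :=
  forall c, I c \in Y c.

Definition homogeneous_at T L (chi : {ffun C -> T} -> T -> L)
    (c : C) (Y : C -> {set T}) : Prop :=
  forall I J : {ffun C -> T}, in_grid Y I -> in_grid Y J -> I c = J c ->
  forall x, x \in Y c -> chi I x = chi J x.

(* The coordinates outside [s] are frozen at their values in [I0]. *)
Lemma grid_ramsey (s : seq C) (q m : nat) : uniq s ->
  exists N : nat, forall T L (X : C -> {set T})
    (chi : {ffun C -> T} -> L) (I0 : {ffun C -> T}),
    #|L| = q -> (forall c, N <= #|X c|) ->
    exists (Y : C -> {set T}) (l : L),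
      [/\ forall c, Y c \subset X c, forall c, m <= #|Y c| &
        forall I : {ffun C -> T}, (forall c, c \in s -> I c \in Y c) ->
          (forall c, c \notin s -> I c = I0 c) -> chi I = l].
Proof.
elim: s q => [|c s IH] q.
  move=> _; exists m => T L X chi I0 _ hX; exists X, (chi I0); split=> // I _ h.
  by congr chi; apply/ffunP => c; rewrite h.
(* [M] elements carrying [q] labels force more than [m] of them to share a label. Recolouring each
   tuple by its row of [M] labels along coordinate [c] uses [q ^ M] colours. *)
move=> /= /andP[cs us]; pose M := (q * m).+1; have [N hN] := IH (q ^ M) us.
exists (maxn M N) => T L X chi I0 hL hX.
have [|Z ZX cZ] := @exists_subset_card T (X c) M.
  by rewrite (leq_trans _ (hX c)) ?leq_maxl.
pose chi' I := [ffun z : {x : T | x \in Z} => chi (upd I c (val z))].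
have csZ : #|{: {x : T | x \in Z}}| = M.
  by rewrite card_sig -cZ; apply: eq_card => x; rewrite inE.
have [||Y [l' [YX mY hY]]] := hN _ _ X chi' I0.
- by rewrite card_ffun hL csZ.
- by move=> e; rewrite (leq_trans _ (hX e)) ?leq_maxr.
have [|l hl] := @exists_large_fiber _ L l' m; first by rewrite hL csZ.
pose W := [set val z | z in [set z | l' z == l]].
exists (fun e => if e == c then W else Y e), l; split=> [e|e|I hI hI0].
- case: eqP => [->|_]//; apply/fintype.subsetP => _ /imsetP[z _ ->].
  by apply: (fintype.subsetP ZX); exact: valP.
- by case: eqP => // _; rewrite card_imset ?(ltnW hl)//; exact: val_inj.
have /imsetP[z] : I c \in W by have := hI c (mem_head _ _); rewrite eqxx.
rewrite inE => /eqP hz Icz.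
(* [hY] needs coordinate [c] frozen at [I0 c]; resetting it is harmless, since [chi'] overwrites
   that coordinate. *)
have -> : I = upd (upd I c (I0 c)) c (val z).
  by apply/ffunP => e; rewrite !ffunE; case: eqP => // ->.
rewrite -hz -(hY (upd I c (I0 c))) ?ffunE// => e es; rewrite ffunE.
  case: (eqVneq e c) es => [->|ec es]; first by rewrite (negbTE cs).
  by have := hI e; rewrite inE es orbT (negbTE ec); apply.
by case: eqVneq => [->//|ec]; rewrite hI0// inE negb_or ec.
Qed.

(** Fix [m] values [Z] in coordinate [c]. Each choice of the other coordinates yields a table of
    labels indexed by the value at [c] and the argument [x], both in [Z]; there are [q ^ (m * m)]
    tables. By [grid_ramsey] on the other coordinates, the table becomes constant. *)
Lemma homogeneous_at_ramsey (c : C) (q m : nat) :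
  exists N : nat, forall T L (X : C -> {set T})
    (chi : {ffun C -> T} -> T -> L) (I0 : {ffun C -> T}),
    #|L| = q -> (forall c, N <= #|X c|) ->
    exists Y : C -> {set T},
      [/\ forall c, Y c \subset X c, forall c, m <= #|Y c| &
        homogeneous_at chi c Y].
Proof.
have us : uniq [seq e <- enum C | e != c] by rewrite filter_uniq// enum_uniq.
have [N hN] := grid_ramsey (q ^ (m * m)) m us.
exists (maxn m N) => T L X chi I0 hL hX.
have [|Z ZX cZ] := @exists_subset_card T (X c) m.
  by rewrite (leq_trans _ (hX c)) ?leq_maxl.
pose chi' I := [ffun z : {x : T | x \in Z} * {x : T | x \in Z} =>
  chi (upd I c (val z.1)) (val z.2)].
have csZ : #|{: {x : T | x \in Z}}| = m.
  by rewrite card_sig -cZ; apply: eq_card => x; rewrite inE.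
have [||Y [l [YX mY hY]]] := hN _ _ X chi' I0.
- by rewrite card_ffun hL card_prod csZ.
- by move=> e; rewrite (leq_trans _ (hX e)) ?leq_maxr.
exists (fun e => if e == c then Z else Y e); split=> [e|e|].
- by case: eqP => [->|].
- by case: eqP => [_|//]; rewrite cZ.
move=> I J hI hJ IJ x; rewrite eqxx => xZ.
have IZ : I c \in Z by have := hI c; rewrite eqxx.
suff chiE K : in_grid (fun e => if e == c then Z else Y e) K -> K c = I c ->
    chi K x = l (exist _ (I c) IZ, exist _ x xZ) by rewrite !chiE.
move=> hK KI; have KE : K = upd (upd K c (I0 c)) c (I c).
  by apply/ffunP => e; rewrite !ffunE; case: eqP => // ->.
rewrite [in LHS]KE -(hY (upd K c (I0 c))) => [|e|e].
- by rewrite ffunE.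
- rewrite mem_filter ffunE => /andP[ec _].
  by have := hK e; rewrite (negbTE ec).
- by rewrite mem_filter mem_enum andbT negbK ffunE => /eqP ->; rewrite eqxx.
Qed.

(** Coordinates are treated one at a time, each shrinking the grid left by the previous one.
    Homogeneity passes to subgrids, so it survives later steps; the size needed for the remaining
    coordinates is the target size of the current one. *)
Lemma homogeneous_ramsey (q m : nat) :
  exists N : nat, forall T L (chi : C -> {ffun C -> T} -> T -> L)
    (I0 : {ffun C -> T}), #|L| = q -> N <= #|T| ->
    exists Y : C -> {set T},
      (forall c, m <= #|Y c|) /\ forall c, homogeneous_at (chi c) c Y.
Proof.
suff [N hN] : exists N : nat, forall T L (X : C -> {set T})
    (chi : C -> {ffun C -> T} -> T -> L) (I0 : {ffun C -> T}),
    #|L| = q -> (forall c, N <= #|X c|) ->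
    exists Y : C -> {set T},
      [/\ forall c, Y c \subset X c, forall c, m <= #|Y c| &
        forall c, c \in enum C -> homogeneous_at (chi c) c Y].
  exists N => T L chi I0 hL hT.
  have [|Y [_ mY hY]] := hN T L (fun=> [set: T]) chi I0 hL.
    by move=> c; rewrite cardsT.
  by exists Y; split=> // c; apply: hY; rewrite mem_enum.
elim: (enum C) => [|c s [N1 IH]].
  by exists m => T L X chi I0 _ hX; exists X; split.
have [N hN] := homogeneous_at_ramsey c q N1.
exists N => T L X chi I0 hL hX.
have [X1 [X1X cX1 hX1]] := hN T L X (chi c) I0 hL hX.
have [Y [YX1 mY hY]] := IH T L X1 chi I0 hL cX1.
exists Y; split=> // [e|e]; first exact: fintype.subset_trans (YX1 e) (X1X e).
rewrite inE => /orP[/eqP ->|/hY//] I J hI hJ IJ x xY.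
apply: hX1 => //; first by move=> f; exact: (fintype.subsetP (YX1 f)).
  by move=> f; exact: (fintype.subsetP (YX1 f)).
exact: (fintype.subsetP (YX1 c)).
Qed.

End GridRamsey.

Local Open Scope classical_set_scope.
Local Open Scope ring_scope.

(** * Separation of points from boxes on a homogeneous subgrid *)

Section BoxHelly.
Variables (R : realType) (d t : nat).
Variables (a b : 'I_d.+1 -> 'I_t -> 'rV[R]_d).
Variable p : {ffun 'I_d.+1 -> 'I_t} -> 'rV[R]_d.
Hypothesis p_in : forall (I : {ffun 'I_d.+1 -> 'I_t}) c k,
  a c (I c) 0 k <= p I 0 k <= b c (I c) 0 k.

(* [None] when [p I] lies in the box [(c, i)]; otherwise a coordinate in which
   [p I] is separated from it, and on which side. *)
Definition separation (c : 'I_d.+1) (I : {ffun 'I_d.+1 -> 'I_t}) (i : 'I_t) :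
    option ('I_d * bool) :=
  [pick kb : 'I_d * bool |
    if kb.2 then p I 0 kb.1 < a c i 0 kb.1 else b c i 0 kb.1 < p I 0 kb.1].

Lemma separation_None c I i k :
  separation c I i = None -> a c i 0 k <= p I 0 k <= b c i 0 k.
Proof.
rewrite /separation; case: pickP => // h _.
have := h (k, true); have := h (k, false).
by move=> /= /negbT + /negbT; rewrite -!leNgt => -> ->.
Qed.

Lemma separation_Some c I i k e : separation c I i = Some (k, e) ->
  if e then p I 0 k < a c i 0 k else b c i 0 k < p I 0 k.
Proof. by rewrite /separation; case: pickP => // -[k' e'] h [<- <-]. Qed.

Definition separates (Y : 'I_d.+1 -> {set 'I_t}) (c : 'I_d.+1) (k : 'I_d) :
    Prop :=
  exists x y, [/\ x \in Y c, y \in Y c & forall I J, in_grid Y I -> in_grid Y J ->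
    I c = x -> J c = y -> p I 0 k < p J 0 k].

(** If box [x] misses [p I], homogeneity puts every [p J] with [J c = I c] on the same side of that
    box in the same coordinate, whereas every [p K] with [K c = x] lies inside it. *)
Lemma homogeneous_dichotomy (Y : 'I_d.+1 -> {set 'I_t}) (c : 'I_d.+1) :
  homogeneous_at (separation c) c Y ->
  (forall I x k, in_grid Y I -> x \in Y c -> a c x 0 k <= p I 0 k <= b c x 0 k) \/
  exists k, separates Y c k.
Proof.
move=> hY; have [h|] := pselect (forall I x, in_grid Y I -> x \in Y c ->
  separation c I x = None).
  by left=> I x k hI hx; apply: separation_None; exact: h.
move=> /existsNP[I /existsNP[x /not_implyP[hI /not_implyP[xY]]]].
case E : (separation c I x) => [[k e]|//] _; right; exists k.
have hsep J : in_grid Y J -> J c = I c ->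
    if e then p J 0 k < a c x 0 k else b c x 0 k < p J 0 k.
  by move=> hJ JI; apply: separation_Some; rewrite (hY _ _ hJ hI JI).
(* The side [e] decides which of the indices [I c] and [x] comes first. *)
case: e {E} hsep => hsep; [exists (I c), x|exists x, (I c)]; split=> //.
- move=> J K hJ hK /(hsep _ hJ)/lt_le_trans pa Kx; apply: pa.
  by have /andP[+ _] := p_in K c k; rewrite Kx.
- move=> J K hJ hK Jx /(hsep _ hK); apply: le_lt_trans.
  by have /andP[_] := p_in J c k; rewrite Jx.
Qed.

Lemma separates_inj (Y : 'I_d.+1 -> {set 'I_t})
    (I0 : {ffun 'I_d.+1 -> 'I_t}) c c' k :
  in_grid Y I0 -> separates Y c k -> separates Y c' k -> c = c'.
Proof.
move=> hI0 [x [y [xY yY xy]]] [x' [y' [xY' yY' xy']]].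
have [//|/negbTE cc'] := eqVneq c c'.
have hupd I e z : in_grid Y I -> z \in Y e -> in_grid Y (upd I e z).
  by move=> hI hz f; rewrite ffunE; case: eqP => // ->.
(* The values are crossed: [I] is the earlier tuple for [c] but the later one for [c']. *)
pose I := upd (upd I0 c x) c' y'; pose J := upd (upd I0 c y) c' x'.
have hI : in_grid Y I by apply/hupd => //; exact/hupd.
have hJ : in_grid Y J by apply/hupd => //; exact/hupd.
have IJ : p I 0 k < p J 0 k by apply: xy; rewrite // !ffunE ?eqxx ?cc'.
have JI : p J 0 k < p I 0 k by apply: xy'; rewrite // !ffunE ?eqxx.
by have := lt_trans IJ JI; rewrite ltxx.
Qed.

Lemma homogeneous_exists_deep_color (Y : 'I_d.+1 -> {set 'I_t})
    (I0 : {ffun 'I_d.+1 -> 'I_t}) : in_grid Y I0 ->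
  (forall c, homogeneous_at (separation c) c Y) ->
  exists c, forall x k, x \in Y c -> a c x 0 k <= p I0 0 k <= b c x 0 k.
Proof.
move=> hI0 hY; apply: contrapT => /forallNP hc.
have /choice[f hf] c : exists k, separates Y c k.
  have [h|//] := homogeneous_dichotomy (hY c).
  by case: (hc c) => x k; exact: h.
have /leq_card : injective f.
  by move=> c c' ff; apply: separates_inj hI0 (hf c) _; rewrite ff.
by rewrite !card_ord ltnn.
Qed.

End BoxHelly.

Theorem theorem4p4 (R : realType) (r d : nat) (r_gt0 : (0 < r)%N) (d_gt0 : (0 < d)%N) :
  exists t : nat,
    forall (F : 'I_d.+1 -> set (set 'rV[R]_d)) (S : set 'rV[R]_d),
      (forall i : 'I_d.+1, F i `<=` @axis_parallel_box R d) ->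
      (forall i : 'I_d.+1, (F i #= `I_t)%card) ->
      discrete_set S ->
      (forall B : 'I_d.+1 -> set 'rV[R]_d,
          (forall i : 'I_d.+1, F i (B i)) ->
          (\bigcap_(i in [set: 'I_d.+1]) B i) `&` S !=set0) ->
      exists (l : 'I_d.+1) (G : set (set 'rV[R]_d)),
        [/\ G `<=` F l, (G #= `I_r)%card & (\bigcap_(B in G) B) `&` S !=set0].
Proof.
have [N hN] := @homogeneous_ramsey 'I_d.+1 #|{: option ('I_d * bool)}| r.
(* The successor makes the index type inhabited, so that [ord0] can supply the base tuple. *)
exists N.+1 => F S Fbox Fcard _ FS.
have /choice[f hf] i : exists f : 'I_N.+1 -> set 'rV[R]_d,
    set_bij [set: 'I_N.+1] (F i) f.
  by apply/card_set_bijP; rewrite (card_eqr (Fcard i)) card_eq_sym card_II.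
have Ff i j : F i (f i j) by have [h _ _] := hf i; exact: h.
have /choice[ab hab] (ij : 'I_d.+1 * 'I_N.+1) : exists ab : 'rV[R]_d * 'rV[R]_d,
    f ij.1 ij.2 = [set x | forall k, ab.1 0 k <= x 0 k <= ab.2 0 k].
  by have [a [b [_ ->]]] := Fbox _ _ (Ff ij.1 ij.2); exists (a, b).
have /choice[p hp] (I : {ffun 'I_d.+1 -> 'I_N.+1}) : exists x : 'rV[R]_d,
    (forall i, f i (I i) x) /\ S x.
  have [|x [fx Sx]] := FS (fun i => f i (I i)); first by move=> i; exact: Ff.
  by exists x; split=> // i; exact: fx.
have p_in (I : {ffun 'I_d.+1 -> 'I_N.+1}) c k :
    (ab (c, I c)).1 0 k <= p I 0 k <= (ab (c, I c)).2 0 k.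
  by have [/(_ c)] := hp I; rewrite (hab (c, I c)) => /(_ k).
have [|Y [rY hY]] := hN 'I_N.+1 _ (separation (fun c i => (ab (c, i)).1)
    (fun c i => (ab (c, i)).2) p) [ffun=> ord0] erefl; first by rewrite card_ord.
have /choice[I0 hI0] c : exists x, x \in Y c.
  by apply/card_gt0P; exact: leq_trans (rY c).
have hI : in_grid Y [ffun c => I0 c] by move=> c; rewrite ffunE.
have [c hc] := homogeneous_exists_deep_color p_in hI hY.
(* [Y c] may have more than [r] indices; [Z] keeps exactly [r], and injectivity of [f c] makes their
   boxes distinct. *)
have [Z ZY Zr] := exists_subset_card (rY c).
exists c, (range (fun j : 'I_#|Z| => f c (enum_val j))); split.
- by move=> _ [j _ <-]; exact: Ff.
- rewrite (card_eql (inj_card_eq _)) ?Zr ?(card_eq_sym _ `I_r) ?card_II//.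
  move=> i j _ _; have [_ inj _] := hf c.
  by move=> /(inj _ _ (in_setT _) (in_setT _)); exact: enum_val_inj.
- exists (p [ffun c => I0 c]); split; last by have [] := hp [ffun c => I0 c].
  move=> _ [j _ <-]; rewrite (hab (c, _)) => k; apply: hc.
  by apply: (fintype.subsetP ZY); exact: enum_valP.
Qed.
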